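(* Let $D \ge 1$ be an integer, $\mathcal{X} = [0,1]^D$, $\mathcal{V} = [0,1]$, let $\mathcal{P} \subseteq [0,1]$ be closed and nonempty, and let $\mathcal{F} = \{(\boldsymbol{\ell},\boldsymbol{u}) \in \mathcal{X}\times\mathcal{X} : \boldsymbol{\ell} \le \boldsymbol{u}\}$. Let $(\boldsymbol{L},\boldsymbol{U},V), (\boldsymbol{L}^1,\boldsymbol{U}^1,V^1), (\boldsymbol{L}^2,\boldsymbol{U}^2,V^2),\ldots$ be a sequence of independent and identically distributed random vectors with support contained in $\mathcal{F}\times\mathcal{V}$, and suppose that $(\boldsymbol{L},\boldsymbol{U}) \in \mathbb{R}^{2D}$ is a continuous random vector with a probability density function $g : \mathbb{R}^{2D} \to [0,\infty)$ (with respect to Lebesgue measure on $\mathbb{R}^{2D}$). Define $$\nu^* = \sup_{\pi : \mathcal{X}\to\mathcal{P}} \mathbb{E}\left[R^\pi(\boldsymbol{L},\boldsymbol{U},V)\right], \qquad \widehat{\nu}_N = \sup_{\pi : \mathcal{X}\to\mathcal{P}} \frac{1}{N}\sum_{i=1}^N R^\pi(\boldsymbol{L}^i,\boldsymbol{U}^i,V^i)$$ for each integer $N > 0$, where both suprema are over all pricing policies $\pi: \mathcal{X}\to\mathcal{P}$. Then $\lim_{N\to\infty} \widehat{\nu}_N = \nu^*$ almost surely.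
   Context: Inequalities between vectors are componentwise, and $[\boldsymbol{\ell},\boldsymbol{u}] = \prod_{d=1}^D [\ell_d,u_d]$. A pricing policy is a Borel measurable function $\pi : \mathcal{X}\to\mathcal{P}$. For a pricing policy $\pi$ and $(\boldsymbol{\ell},\boldsymbol{u},v)\in\mathcal{F}\times\mathcal{V}$, the revenue is $$R^\pi(\boldsymbol{\ell},\boldsymbol{u},v) = \mathbb{I}\left\{\inf_{\boldsymbol{x}\in[\boldsymbol{\ell},\boldsymbol{u}]}\pi(\boldsymbol{x}) \le v\right\}\cdot \inf_{\boldsymbol{x}\in[\boldsymbol{\ell},\boldsymbol{u}]}\pi(\boldsymbol{x}),$$ where $\mathbb{I}\{\cdot\}$ is the zero-one indicator. Expectations and almost-sure statements are with respect to the completed probability measure. *)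

(* Defs.v *)
From HB Require Import structures.
From mathcomp Require Import all_boot all_order all_algebra.
From mathcomp Require Import finmap.
From mathcomp Require Import all_classical all_reals all_analysis.

Set Implicit Arguments.
Unset Strict Implicit.
Unset Printing Implicit Defensive.

Import Order.TTheory GRing.Theory Num.Theory.
Import numFieldNormedType.Exports.

Local Open Scope classical_set_scope.
Local Open Scope ring_scope.

(* R^n is [n.-tuple R]; its sigma-algebra, generated by the coordinates, is the
   Borel sigma-algebra.  Lebesgue measure on R is declared on [measurableTypeR R],
   a copy of R with the same measurable sets. *)

Section lebesgue_tuple.
Context {R : realType}.

Definition cons_pair n (p : measurableTypeR R * n.-tuple R) : n.+1.-tuple R :=
  [tuple of p.1 :: p.2].

Lemma measurable_cons_pair n : measurable_fun setT (@cons_pair n).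
Proof. by apply: measurable_cons. Qed.

Definition uncons_pair n (t : n.+1.-tuple R) : measurableTypeR R * n.-tuple R :=
  (thead t, [tuple of behead t]).

Lemma measurable_uncons_pair n : measurable_fun setT (@uncons_pair n).
Proof.
apply/measurable_fun_pairP; split.
- exact: (measurable_tnth ord0).
- exact: measurable_behead.
Qed.

Lemma cons_pairK n : cancel (@cons_pair n) (@uncons_pair n).
Proof.
by case=> x t; rewrite /cons_pair/uncons_pair theadE; congr pair; exact/val_inj.
Qed.

Section step.
Variables (n : nat) (m : {sigma_finite_measure set (n.-tuple R) -> \bar R}).

Definition lebesgue_tupleS : set (n.+1.-tuple R) -> \bar R :=
  pushforward (lebesgue_measure \x m)%E (@cons_pair n).

Let lebesgue_tupleS0 : lebesgue_tupleS set0 = 0%E.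
Proof. by apply: measure0 => //; exact: measurable_cons_pair. Qed.

Let lebesgue_tupleS_ge0 A : (0 <= lebesgue_tupleS A)%E.
Proof. by apply: measure_ge0 => //; exact: measurable_cons_pair. Qed.

Let lebesgue_tupleS_sigma_additive : semi_sigma_additive lebesgue_tupleS.
Proof.
by apply: measure_semi_sigma_additive => //; exact: measurable_cons_pair.
Qed.

HB.instance Definition _ := isMeasure.Build _ _ _ lebesgue_tupleS
  lebesgue_tupleS0 lebesgue_tupleS_ge0 lebesgue_tupleS_sigma_additive.

Let sigma_finite_lebesgue_tupleS : sigma_finite setT lebesgue_tupleS.
Proof.
have /sigma_finiteP[F [FT ndF mF]] := sigma_finiteT (@lebesgue_measure R).
have /sigma_finiteP[G [GT ndG mG]] := sigma_finiteT m.
exists (fun k => @uncons_pair n @^-1` (F k `*` G k)).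
  apply/esym; rewrite -subTset => t _.
  have [i _ Fi] : (\bigcup_i F i) (uncons_pair t).1 by rewrite -FT.
  have [j _ Gj] : (\bigcup_j G j) (uncons_pair t).2 by rewrite -GT.
  exists (maxn i j) => //; split.
    by move: Fi; exact/subsetPset/ndF/leq_maxl.
  by move: Gj; exact/subsetPset/ndG/leq_maxr.
move=> k; have [mFk Fkoo] := mF k; have [mGk Gkoo] := mG k; split.
  rewrite -[X in measurable X]setTI; apply: measurable_uncons_pair => //.
  exact: measurableX.
rewrite /lebesgue_tupleS /pushforward -comp_preimage.
rewrite (_ : _ \o _ = id); last by apply/funext => p /=; rewrite cons_pairK.
by rewrite preimage_id product_measure1E// lte_mul_pinfty// ge0_fin_numE.
Qed.

HB.instance Definition _ := Measure_isSigmaFinite.Build _ _ _ lebesgue_tupleS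
  sigma_finite_lebesgue_tupleS.

End step.

(* Lebesgue measure on R^n, as the n-fold product of Lebesgue measure on R. *)
Fixpoint lebesgue_tuple n : {sigma_finite_measure set (n.-tuple R) -> \bar R} :=
  match n with
  | 0 => \d_([tuple] : 0.-tuple R)
  | n'.+1 => lebesgue_tupleS (lebesgue_tuple n')
  end.

Lemma lebesgue_tuple_box n (A : 'I_n -> set R) :
  (forall i, measurable (A i)) ->
  lebesgue_tuple n [set t | forall i, A i (tnth t i)] =
  (\prod_(i < n) lebesgue_measure (A i))%E.
Proof.
elim: n A => [|n IHn] A mA.
  by rewrite big_ord0 /= diracE mem_set//= => -[].
have mB : measurable [set t : n.-tuple R | forall i, A (lift ord0 i) (tnth t i)].
  rewrite (_ : [set _ | _] = \bigcap_(i in [set: 'I_n])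
      ((fun t : n.-tuple R => tnth t i) @^-1` A (lift ord0 i))).
    apply: fin_bigcap_measurable => // i _.
    by rewrite -[X in measurable X]setTI; exact: measurable_tnth.
  by apply/seteqP; split => t /= At i; [move=> _; exact: At|exact: (At i I)].
rewrite big_ord_recl -IHn// -product_measure1E//; last exact: mA.
rewrite /= /lebesgue_tupleS /pushforward; congr (product_measure1 _ _ _).
apply/seteqP; split => -[x t] /=; rewrite /cons_pair.
  move=> At; split; first by have := At ord0; rewrite tnth0.
  by move=> i; have := At (lift ord0 i); rewrite tnthS.
by move=> [Ax At] i; case: (unliftP ord0 i) => [j ->|->//]; rewrite tnthS.
Qed.

End lebesgue_tuple.
Arguments lebesgue_tuple {R} n.

Section completion.
Context d (T : measurableType d) (R : realType) (P : probability T R).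

(* The completion of P is the outer measure of P restricted to its Caratheodory
   sigma-algebra; as P is finite, the latter consists exactly of the measurable
   sets modified by subsets of P-null sets. *)
Definition completion := @completed_measure_extension _ _ _ P.

HB.instance Definition _ := Measure.on completion.

Let completion_setT : completion setT = 1%E.
Proof.
rewrite /completion /completed_measure_extension measurable_mu_extE//.
exact: probability_setT.
Qed.

HB.instance Definition _ :=
  Measure_isProbability.Build _ _ _ completion completion_setT.

End completion.
Arguments completion {d T R} P.

Section probability.
Context d (T : measurableType d) (R : realType) (P : probability T R).

Definition mutually_independent d' (T' : measurableType d')
    (Z : nat -> T -> T') : Prop :=
  forall (J : {fset nat}) (A : nat -> set T'), (forall j, measurable (A j)) ->
    P (\bigcap_(j in [set` J]) (Z j @^-1` A j)) =
    (\prod_(j <- J) P (Z j @^-1` A j))%E.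

Definition identically_distributed d' (T' : measurableType d')
    (Z : nat -> T -> T') : Prop :=
  forall (i j : nat) (A : set T'), measurable A ->
    P (Z i @^-1` A) = P (Z j @^-1` A).

Definition has_density n (X : T -> n.-tuple R) (g : n.-tuple R -> R) : Prop :=
  [/\ measurable_fun setT g, (forall x, 0 <= g x) &
      forall A, measurable A ->
        P (X @^-1` A) = (\int[lebesgue_tuple n]_(x in A) (g x)%:E)%E].

Definition cube_nbhd n (x : n.-tuple R) (e : R) : set (n.-tuple R) :=
  [set y | forall i, `|tnth x i - tnth y i| < e].

(* The points all of whose neighbourhoods have positive probability; the open
   cubes form a basis of neighbourhoods in R^n * R^n * R. *)
Definition law_support n (Z : T -> n.-tuple R * n.-tuple R * R) :
    set (n.-tuple R * n.-tuple R * R)%type :=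
  [set z | forall e : R, 0 < e ->
     (0 < P (Z @^-1` (cube_nbhd z.1.1 e `*` cube_nbhd z.1.2 e `*`
                      [set v | (`|z.2 - v| < e)%R])))%E].

End probability.
Arguments mutually_independent {d T R} P {d' T'} Z.
Arguments identically_distributed {d T R} P {d' T'} Z.
Arguments has_density {d T R} P {n} X g.
Arguments law_support {d T R} P {n} Z.

Section pricing.
Context {R : realType} (D : nat).

Definition vle (x y : D.-tuple R) : Prop := forall i, tnth x i <= tnth y i.

Definition box (l u : D.-tuple R) : set (D.-tuple R) :=
  [set x | vle l x /\ vle x u].

Definition unit_cube : set (D.-tuple R) :=
  [set x | forall i, 0 <= tnth x i <= 1].

Definition feasible : set (D.-tuple R * D.-tuple R)%type :=
  [set lu | [/\ unit_cube lu.1, unit_cube lu.2 & vle lu.1 lu.2]].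

(* A map X -> prices is represented by a total function; its values outside
   the unit cube X are unconstrained and irrelevant. *)
Definition policy (prices : set R) : set (D.-tuple R -> R) :=
  [set pi | measurable_fun unit_cube pi /\
            forall x, unit_cube x -> prices (pi x)].

Definition revenue (pi : D.-tuple R -> R) (l u : D.-tuple R) (v : R) : R :=
  (inf (pi @` box l u) <= v)%R%:R * inf (pi @` box l u).

End pricing.
Arguments unit_cube {R} D.
Arguments feasible {R} D.
Arguments policy {R} D prices.

Section values.
Context {R : realType} {D : nat} d (T : measurableType d) (P : probability T R).
Variables (prices : set R) (L U : nat -> T -> D.-tuple R) (V : nat -> T -> R).

(* Index 0 is the generic observation (L, U, V); indices i >= 1 are the sample
   (L^i, U^i, V^i). *)
Definition nu_star : \bar R :=
  ereal_sup [set 'E_(completion P)[fun w => revenue pi (L 0%N w) (U 0%N w) (V 0%N w)]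
            | pi in policy D prices]%E.

Definition nu_hat (N : nat) (w : T) : \bar R :=
  ereal_sup [set (N%:R^-1 *
               \sum_(1 <= i < N.+1) revenue pi (L i w) (U i w) (V i w))%:E
            | pi in policy D prices].

End values.
Arguments nu_star {R D d T} P prices L U V.
Arguments nu_hat {R D d T} prices L U V N w.

(* Main.v *)
(* Replacing the prices of a policy by slightly smaller ones from a finite set loses
   little revenue, because lowering the infimum over a box can only turn a lost sale
   into a sale.  For a policy with finitely many prices, the infimum over a box is
   monotone in the box, i.e. in the 2D coordinates [(1 - l, u)].  Cut [[0, 1]^(2D)]
   into M^(2D) equal cells: by monotonicity the infimum is constant on all cells
   except O(M^(2D - 1)) of them, and these have small probability since (L, U) has a
   density.  On the other cells the revenue is a combination of the indicators of the
   finitely many events "(l, u) lies in a given cell and v is at least a given price",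
   so that the strong law for these events alone makes the sample revenues of all
   discretised policies converge uniformly.  Uniform convergence fails without the
   discretisation: the class of all functions [1{h(l, u) <= v}] with [h] monotone is
   too rich if v is a function of (l, u). *)
Require Import Defs.
From mathcomp Require Import all_boot all_order all_algebra.
From mathcomp Require Import finmap.
From mathcomp Require Import all_classical all_reals all_analysis.
From mathcomp Require Import measurable_realfun ring lra zify.
Set Implicit Arguments.
Unset Strict Implicit.
Unset Printing Implicit Defensive.
Import Order.TTheory GRing.Theory Num.Theory.
Import numFieldNormedType.Exports.
Local Open Scope classical_set_scope.
Local Open Scope ring_scope.

(** * Jumps of monotone functions on a grid *)

Section jumps.
Local Open Scope nat_scope.

Lemma card_ffun_coord n m (i : 'I_n) (c : 'I_m) :
  #|[pred a : {ffun 'I_n -> 'I_m} | a i == c]| = (m ^ n.-1)%N.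
Proof.
pose F j := if j == i then pred1 c else predT.
transitivity #|family F|.
  apply: eq_card => a; rewrite !inE; apply/idP/familyP => [/eqP aic j|/(_ i)].
    by rewrite /F; case: eqP => [->|_]; rewrite inE ?aic.
  by rewrite /F eqxx inE.
rewrite card_family foldrE big_map big_enum (bigD1 i)//= /F eqxx card1 mul1n.
rewrite (eq_bigr (fun=> m)) => [|j /negPf ->]; last by rewrite cardT size_enum_ord.
by rewrite prod_nat_const cardC1 card_ord.
Qed.

(* The cyclic shift [a |-> a + 1 mod M] is a bijection of the cells that agrees
   with [a |-> a + 1] away from the last layers, so the sums of [F a] and of
   [F (a + 1)] differ by at most the contribution of these layers. *)
Lemma card_jump n m K (F : ('I_n -> nat) -> nat) :
    (forall a b, (forall i, a i <= b i) -> F b <= F a) ->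
    (forall a, F a <= K) ->
  #|[pred a : {ffun 'I_n -> 'I_m.+1} | F (fun i => a i) != F (fun i => (a i).+1)]| <=
  K * (n * m.+1 ^ n.-1).
Proof.
move=> Fni FK.
pose G (a : {ffun 'I_n -> 'I_m.+1}) := F (fun i => (a i).+1).
pose s (a : {ffun 'I_n -> 'I_m.+1}) := [ffun i => ordS (a i)].
pose E (a : {ffun 'I_n -> 'I_m.+1}) := [exists i, a i == ord_max].
have sK : cancel s (fun a => [ffun i => ord_pred (a i)]).
  by move=> a; apply/ffunP => i; rewrite !ffunE ordSK.
have sumF : \sum_(a : {ffun 'I_n -> 'I_m.+1}) F (fun i => a i) <= \sum_a (G a + K * E a).
  rewrite (reindex_inj (can_inj sK)); apply: leq_sum => a _.
  have [_|aE] := boolP (E a); first by rewrite muln1 (leq_trans (FK _)) ?leq_addl.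
  rewrite muln0 addn0 Fni// => i; rewrite ffunE /=.
  move: aE; rewrite negb_exists => /forallP/(_ i) ai.
  have ? : a i < m.
    by rewrite ltn_neqAle -ltnS ltn_ord andbT; apply: contra ai => /eqP ai; apply/eqP/val_inj.
  by rewrite modn_small.
have sumE : \sum_a E a <= n * m.+1 ^ n.-1.
  apply: (@leq_trans (\sum_(a : {ffun 'I_n -> 'I_m.+1}) \sum_i (a i == ord_max))).
    apply: leq_sum => a _; rewrite /E; case: existsP => // -[i ai].
    by rewrite (bigD1 i)//= ai.
  rewrite exchange_big/= (eq_bigr (fun=> m.+1 ^ n.-1)) => [|i _].
    by rewrite sum_nat_const card_ord.
  by rewrite -(card_ffun_coord i ord_max) -sum1_card [RHS]big_mkcond.
(* At a jump, [F a] exceeds [G a] by at least one, so adding the number of jumps to the sum of [G]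
   stays below the sum of [F]. *)
rewrite -(leq_add2l (\sum_a G a)).
apply: (@leq_trans (\sum_(a : {ffun 'I_n -> 'I_m.+1}) F (fun i => a i))).
  rewrite -sum1_card [X in _ + X]big_mkcond/= -big_split/=; apply: leq_sum => a _ /=.
  have FG : G a <= F (fun i => a i) by exact: Fni.
  rewrite inE; case: ifPn => [neq|_]; last by rewrite addn0.
  by rewrite addn1 ltn_neqAle FG andbT eq_sym.
rewrite (leq_trans sumF)// big_split leq_add2l -big_distrr/= leq_mul2l sumE.
by rewrite orbT.
Qed.

End jumps.

(** * Densities *)

Section density.
Context d (T : measurableType d) (R : realType) (P : probability T R).

(** Truncation of the density: where [g <= k] the probability is at most [k] times the volume, and
    the event that [g] exceeds [k] at [X] has small probability for large [k], because [g] is finite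
    everywhere. *)
Lemma density_absolutely_continuous n (X : T -> n.-tuple R) (g : n.-tuple R -> R) :
    measurable_fun setT X -> has_density P X g ->
  forall e : R, 0 < e -> exists2 del : R, 0 < del &
    forall A, measurable A -> (lebesgue_tuple n A <= del%:E)%E ->
      (P (X @^-1` A) <= e%:E)%E.
Proof.
move=> mX [mg g0 Pg] e e0.
pose B k := [set x | k%:R < g x].
have mB k : measurable (B k).
  rewrite [B k](_ : _ = setT `&` g @^-1` `]k%:R, +oo[%classic); first exact: mg.
  by apply/seteqP; split=> x; rewrite /B/= in_itv/= andbT => // -[].
have mXA A : measurable A -> measurable (X @^-1` A).
  by move=> mA; rewrite -[X in measurable X]setTI; exact: mX.
have B0 : \bigcap_k (X @^-1` B k) = set0.
  apply/seteqP; split => // w /(_ (Num.truncn (g (X w))).+1 I).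
  by rewrite /B/= ltNge (ltW (truncnS_gt _)).
have PB : P (X @^-1` B k) @[k --> \oo] --> 0%E.
  rewrite -(measure0 P) -B0; apply: nonincreasing_cvg_mu => //.
  - by rewrite -ge0_fin_numE// fin_num_measure//; exact: mXA.
  - by move=> k; exact: mXA.
  - by rewrite B0.
  - move=> k m km; apply/subsetPset => w; rewrite /B/=; apply: le_lt_trans.
    by rewrite ler_nat.
have [k Pk] : exists k, (P (X @^-1` B k) <= (e / 2)%:E)%E.
  have := PB; move=> /fine_cvgP[fP /cvgrPdist_le/(_ (e / 2)(divr_gt0 e0 (ltr0Sn R 1)))].
  move=> /(filterI fP) [k _ /(_ k (leqnn k)) [fk]]; exists k.
  rewrite -[leLHS]fineK// lee_fin.
  by move: b; rewrite sub0r normrN ger0_norm// fine_ge0.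
(* Dividing by [k + 1] rather than [k] covers [k = 0]. *)
exists (e / 2 / k.+1%:R); first by rewrite !divr_gt0.
move=> A mA Adel.
rewrite (@le_trans _ _ (P (X @^-1` (A `\` B k)) + P (X @^-1` B k))%E)//.
  apply: le_trans (measureU2 _ _ _); rewrite ?inE; try exact: mXA.
    apply: le_measure; rewrite ?inE; first exact: mXA.
      by apply: measurableU; apply: mXA => //; exact: measurableD.
    by move=> w Aw; have [Bw|Bw] := pselect (B k (X w)); [right|left].
  by apply: mXA; exact: measurableD.
rewrite [e in leRHS]splitr EFinD leeD// Pg; last exact: measurableD.
rewrite (@le_trans _ _ (\int[lebesgue_tuple n]_(x in A `\` B k) (cst k%:R%:E x))%E)//.
  apply: ge0_le_integral => //; first exact: measurableD.
  - by move=> x _; rewrite lee_fin.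
  - by apply/measurable_EFinP; exact: measurable_funTS.
  - by move=> x [_ /negP]; rewrite -leNgt lee_fin.
rewrite integral_cst//; last exact: measurableD.
rewrite (@le_trans _ _ (k%:R%:E * (e / 2 / k.+1%:R)%:E)%E)//.
  rewrite lee_wpmul2l ?lee_fin// (le_trans _ Adel)// le_measure ?inE//.
  exact: measurableD.
rewrite -EFinM lee_fin mulrCA ler_piMr ?divr_ge0 ?(ltW e0)//.
by rewrite ler_pdivrMr// mul1r ler_nat.
Qed.

End density.

Lemma measurable_cat_tuple d (T : measurableType d) (R : realType) n p
    (f : T -> n.-tuple R) (g : T -> p.-tuple R) :
  measurable_fun setT f -> measurable_fun setT g ->
  measurable_fun setT (fun w => cat_tuple (f w) (g w)).
Proof.
move=> mf mg; apply/measurable_fun_tnthP => i; case: (split_ordP i) => j ->.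
  rewrite (_ : _ \o _ = fun w => tnth (f w) j).
    exact: measurableT_comp (measurable_tnth j) mf.
  by apply/funext => w /=; rewrite tnth_lshift.
rewrite (_ : _ \o _ = fun w => tnth (g w) j).
  exact: measurableT_comp (measurable_tnth j) mg.
by apply/funext => w /=; rewrite tnth_rshift.
Qed.

(** * Strong law for events *)

Section prob.
Context d (T : measurableType d) (R : realType) (P : probability T R).

Definition prob (A : set T) : R := fine (P A).

Lemma probE A : measurable A -> P A = (prob A)%:E.
Proof. by move=> mA; rewrite fineK// fin_num_measure. Qed.

Lemma integral_sum_indic (I : finType) (c : I -> R) (A : I -> set T) :
  (forall i, measurable (A i)) ->
  (\int[P]_w (\sum_i c i * \1_(A i) w)%:E = (\sum_i c i * prob (A i))%:E)%E.
Proof.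
move=> mA.
have intA i : P.-integrable setT (EFin \o \1_(A i)) by exact: integrable_indic.
under eq_integral do rewrite -sumEFin.
rewrite integral_sum//=; last first.
  by move=> i; under eq_fun do rewrite EFinM; move: (integrableZl measurableT (c i) (intA i)).
rewrite -sumEFin; apply: eq_bigr => i _.
under eq_integral do rewrite EFinM.
rewrite (integralZl measurableT (intA i)) integral_indic// setIT. 
by rewrite EFinM; congr (_ * _)%E; exact: probE.
Qed.

End prob.

(* Between consecutive squares [(k + 1)^2 <= n < (k + 2)^2] the sum grows by at
   most [2k + 2], which is negligible with respect to [n]. *)
Lemma cvg_mean_of_squares (R : realType) (s : nat -> R) (p : R) :
    0 <= p <= 1 -> (forall n m, 0 <= s (n + m)%N - s n <= m%:R) ->
    s (k.+1 ^ 2)%N / (k.+1 ^ 2)%:R @[k --> \oo] --> p ->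
  n%:R^-1 * s n @[n --> \oo] --> p.
Proof.
move=> /andP[p0 p1] ds /cvgrPdist_le sq; apply/cvgrPdist_le => e e0.
have [k0 _ k0P] := sq (e / 2) (divr_gt0 e0 (ltr0Sn R 1)).
(* The threshold [4 / e] makes the growth [2 (k + 1)] between squares at most [e / 2] times
   [(k + 1)^2]. *)
have [k1 k1P] : exists k1 : nat, 4 / e < k1%:R.
  by exists (Num.truncn (4 / e)).+1; exact: truncnS_gt.
pose k2 := (k0 + k1).+1; exists (k2 ^ 2)%N => // n /= k2n.
have [r rn] : exists r, (r ^ 2 <= n < r.+1 ^ 2)%N.
  elim: n {k2n} => [|m [r rm]]; first by exists 0%N.
  have [mr|mr] := ltnP m.+1 (r.+1 ^ 2); first by exists r; lia.
  by exists r.+1; nia.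
have [k /andP[k0k k1k] rk] : exists2 k, (k0 <= k)%N && (k1 <= k)%N & r = k.+1.
  by exists r.-1; [apply/andP; split; nia|nia].
have [/andP[sqn nsq] n0] : (k.+1 ^ 2 <= n <= k.+1 ^ 2 + (k.+1).*2)%N /\ (0 < n)%N.
  by move: rn; rewrite rk; split; nia.
pose m := (n - k.+1 ^ 2)%N; have nE : n = (k.+1 ^ 2 + m)%N by rewrite subnKC.
have m2 : m%:R <= 2 * k.+1%:R :> R by rewrite -natrM ler_nat; lia.
have := ds (k.+1 ^ 2)%N m; rewrite -nE => /andP[ds0 dsm].
have sq0 : 0 < (k.+1 ^ 2)%:R :> R by rewrite ltr0n expn_gt0.
have nR : n%:R = (k.+1 ^ 2)%:R + m%:R :> R by rewrite nE natrD.
have n0R : 0 < n%:R :> R by rewrite ltr0n.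
have := k0P k k0k; set q := (k.+1 ^ 2)%:R in sq0 nR *.
set t := s (k.+1 ^ 2)%N in ds0 dsm *.
have -> : p - t / q = (q * p - t) / q by field; rewrite lt0r_neq0.
rewrite normrM normfV (gtr0_norm sq0) ler_pdivrMr// => tq.
have -> : p - n%:R^-1 * s n = (n%:R * p - s n) / n%:R by field; rewrite lt0r_neq0.
rewrite normrM normfV (gtr0_norm n0R) ler_pdivrMr//.
have mp : 0 <= m%:R * p <= m%:R by rewrite mulr_ge0//= ler_piMr.
have me : m%:R <= e / 2 * n%:R.
  have kk : 4 / e <= k.+1%:R by rewrite (le_trans (ltW k1P))// ler_nat; lia.
  rewrite (le_trans m2)// (@le_trans _ _ (e / 2 * q))//; last first.
    by rewrite ler_wpM2l ?divr_ge0 ?(ltW e0)// nR lerDl.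
  rewrite /q natrX expr2 mulrA ler_wpM2r// -ler_pdivrMl ?divr_gt0//.
  by rewrite (_ : (e / 2)^-1 * 2 = 4 / e)//; field; rewrite lt0r_neq0.
have mq : e / 2 * q <= e / 2 * n%:R.
  by rewrite ler_wpM2l ?divr_ge0 ?(ltW e0)// nR lerDl.
have : - (e / 2 * q) <= q * p - t <= e / 2 * q by rewrite -ler_norml.
rewrite ler_norml nR mulrDl; rewrite nR in me mq; move: mp => /andP[? ?].
by move=> /andP[? ?]; apply/andP; split; lra.
Qed.

Section slln.
Context d (T : measurableType d) (R : realType) (P : probability T R).
Variables (E : nat -> set T) (p : R).
Hypothesis mE : forall i, measurable (E i).
Hypothesis PE : forall i, P (E i) = p%:E.
Hypothesis PEI : forall i j, i != j -> P (E i `&` E j) = (p * p)%:E.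

Let S n w : R := \sum_(1 <= i < n.+1) \1_(E i) w.

Let p01 : 0 <= p <= 1.
Proof. by rewrite -!lee_fin -(PE 0) measure_ge0 probability_le1. Qed.

(** Pairwise independence removes the covariances; only the variances [p - p ^+ 2] of the [n]
    indicators remain. *)
Lemma second_moment_frequency n :
  (\int[P]_w ((S n w - n%:R * p) ^+ 2)%:E = (n%:R * (p - p ^+ 2))%:E)%E.
Proof.
(* The three summands of the index type list the terms of [S n ^+ 2], of [- 2 n p S n] and of
   [(n p) ^+ 2] in the expanded square. *)
pose A (x : 'I_n * 'I_n + 'I_n + 'I_1) := match x with
  | inl (inl (i, j)) => E i.+1 `&` E j.+1 | inl (inr i) => E i.+1 | inr _ => setT
  end.
pose c (x : 'I_n * 'I_n + 'I_n + 'I_1) : R := match x with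
  | inl (inl _) => 1 | inl (inr _) => - (2 * (n%:R * p)) | inr _ => (n%:R * p) ^+ 2
  end.
rewrite (eq_integral (fun w => (\sum_x c x * \1_(A x) w)%:E)); last first.
  move=> w _; congr EFin; rewrite !big_sumType/= big_ord1 indicT mulr1.
  rewrite -!big_distrr/= mul1r sqrrB /S big_add1/= big_mkord; congr (_ + _); congr (_ + _); last first.
    by ring.
  rewrite expr2 big_distrlr/= pair_big; apply: eq_bigr => -[i j] _ /=.
  by rewrite indicI.
rewrite integral_sum_indic; last first.
  by move=> [[[i j]|i]|i] /=; [exact: measurableI|exact: mE|exact: measurableT].
congr EFin; rewrite !big_sumType/= big_ord1/= {3}/prob probability_setT mulr1.
rewrite -!big_distrr/= mul1r.
rewrite [X in - _ * X](eq_bigr (fun=> p)) => [|i _]; last by rewrite /prob PE.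
rewrite sumr_const card_ord.
rewrite (eq_bigr (fun ij : 'I_n * 'I_n => p ^+ 2 + (p - p ^+ 2) * (ij.1 == ij.2)%:R)).
  rewrite big_split/= sumr_const card_prod card_ord -big_distrr/=.
  rewrite -(pair_big xpredT xpredT (fun i j : 'I_n => (i == j)%:R))/=.
  rewrite (eq_bigr (fun=> 1 : R)) => [|i _]; last first.
    rewrite (bigD1 i)//= eqxx big1 ?addr0// => j /negPf.
    by rewrite eq_sym => ->.
  rewrite sumr_const card_ord -[p ^+ 2 *+ _]mulr_natr -[p *+ n]mulr_natr natrM.
  by move: (n%:R : R) => N; ring.
move=> [i j] _ /=; rewrite /prob; case: eqVneq => [->|ij].
  by rewrite setIid PE/= mulr1 addrC subrK.
by rewrite PEI//= mulr0 addr0.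
Qed.

Lemma measurable_occurrences n : measurable_fun setT (S n).
Proof. by apply: measurable_sum => i; exact: measurable_indic. Qed.

Let sq k : R := ((k.+1) ^ 2)%:R.

(** Along the squares the second moments are summable, so the series of squared deviations has
    finite integral. It is therefore finite almost everywhere, and its terms tend to 0. *)
Lemma frequency_squares :
  {ae P, forall w, S (k.+1 ^ 2) w / sq k @[k --> \oo] --> p}.
Proof.
pose Y k w : R := (S (k.+1 ^ 2) w / sq k - p) ^+ 2.
have sq0 k : 0 < sq k by rewrite ltr0n expn_gt0.
have mY k : measurable_fun setT (EFin \o Y k).
  apply/measurable_EFinP; apply: measurable_funX; apply: measurable_funB => //.
  by apply: measurable_funM => //; exact: measurable_occurrences.
have Y0 k w : (0 <= (Y k w)%:E)%E by rewrite lee_fin sqr_ge0.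
(* The bound [(p - p ^+ 2) / (k + 1)^2] is weakened to a telescoping difference, whose sum is at
   most 2. *)
have intY k : (\int[P]_w (Y k w)%:E <= (2 / k.+1%:R - 2 / k.+2%:R)%:E)%E.
  rewrite (eq_integral (fun w => ((sq k ^- 2)%:E *
      ((S (k.+1 ^ 2) w - sq k * p) ^+ 2)%:E)%E)); last first.
    move=> w _; rewrite -EFinM; congr EFin; rewrite /Y.
    by field; rewrite lt0r_neq0.
  rewrite ge0_integralZl_EFin//; last first.
  - by rewrite invr_ge0 sqr_ge0.
  - apply/measurable_EFinP; apply: measurable_funX; apply: measurable_funB => //.
    exact: measurable_occurrences.
  - by move=> w _; rewrite lee_fin sqr_ge0.
  rewrite second_moment_frequency -EFinM lee_fin.
  have -> : 2 / k.+1%:R - 2 / k.+2%:R = 2 / (k.+1%:R * k.+2%:R) :> R.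
    have k1 : k.+1%:R != 0 :> R by rewrite pnatr_eq0.
    have : k.+2%:R != 0 :> R by rewrite pnatr_eq0.
    rewrite -[k.+2%:R]natr1; move: (k.+1%:R : R) k1 => x x0 x1.
    by field; rewrite x0 x1.
  have -> : sq k ^- 2 * (sq k * (p - p ^+ 2)) = (p - p ^+ 2) / sq k.
    by field; rewrite lt0r_neq0.
  rewrite ler_pdivrMr// mulrAC ler_pdivlMr ?mulr_gt0 ?ltr0n//.
  rewrite (@le_trans _ _ (1 * (k.+1%:R * k.+2%:R)))//.
    rewrite ler_wpM2r ?mulr_ge0//; have /andP[p0 p1] := p01.
    by rewrite (le_trans _ p1)// gerBl sqr_ge0.
  by rewrite mul1r /sq -natrM -natrM ler_nat; nia.
have sumY : (\sum_(k <oo) \int[P]_w (Y k w)%:E <= 2%:E)%E.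
  apply: lime_le.
    by apply: is_cvg_nneseries => k _ _; exact: integral_ge0.
  apply: nearW => n; rewrite (@le_trans _ _ (2 - 2 / n.+1%:R)%:E)//; last first.
    by rewrite lee_fin gerBl divr_ge0.
  elim: n => [|n IHn]; first by rewrite big_geq// divr1 subrr.
  rewrite big_nat_recr//= (le_trans (leeD IHn (intY n)))// -EFinD lee_fin.
  by rewrite addrA subrK.
have iY : P.-integrable setT (fun w => (\sum_(k <oo) (Y k w)%:E)%E).
  apply/integrableP; split.
    by apply: (ge0_emeasurable_sum (P := predT)) => [k w _ _|k _]; [exact: Y0|exact: mY].
  under eq_integral do rewrite gee0_abs ?nneseries_ge0//.
  by rewrite integral_nneseries// (le_lt_trans sumY)// ltry.
apply: filterS (integrable_ae measurableT iY) => w /(_ I) Yfin.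
have : cvgn (series (Y ^~ w)).
  apply: nondecreasing_is_cvgn.
    by apply: nondecreasing_series => k _ _; exact: sqr_ge0.
  exists (fine (\sum_(k <oo) (Y k w)%:E)%E) => _ [n _ <-].
  rewrite -lee_fin fineK// /series/= -sumEFin.
  exact: nneseries_lim_ge.
move/cvg_series_cvg_0 => Y0w; apply/cvgrPdist_lt => e e0.
have /cvgrPdist_lt/(_ (e ^+ 2) (exprn_gt0 _ e0)) := Y0w.
apply: filterS => k; rewrite sub0r normrN normrX ltr_pXn2r ?nnegrE ?(ltW e0)//.
by rewrite distrC.
Qed.

Lemma strong_law_events :
  {ae P, forall w, n%:R^-1 * S n w @[n --> \oo] --> p}.
Proof.
apply: filterS frequency_squares => w.
have SS n m : 0 <= S (n + m) w - S n w <= m%:R.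
  rewrite /S (big_cat_nat (n := n.+1))//= ?ltnS ?leq_addr// addrAC subrr add0r.
  rewrite sumr_ge0//= (@le_trans _ _ (\sum_(n.+1 <= i < (n + m).+1) 1))//.
    by apply: ler_sum => i _; rewrite indicE lern1 leq_b1.
  by rewrite sumr_const_nat subSS addKn.
exact: cvg_mean_of_squares.
Qed.
End slln.

(** * Discretised policies *)

Section discretisation.
Context {R : realType} {D : nat}.
Implicit Types (prices : set R) (pi : D.-tuple R -> R) (l u : D.-tuple R).

Lemma closed_inf (E : set R) : closed E -> E !=set0 -> has_lbound E -> E (inf E).
Proof.
move=> /closure_id cE E0 El; rewrite [E in E _]cE => B /nbhs_ballP[e /= e0 eB].
have [x Ex xe] := inf_adherent e0 (conj E0 El).
exists x; split => //; apply: eB; rewrite /ball/= distrC ger0_norm.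
  by rewrite ltrBlDl.
by rewrite subr_ge0; exact: ge_inf.
Qed.

(* The cheapest admissible price above the level [m / K]; the price 1 is added so
   that [floor_price] is nondecreasing even where no such price exists. *)
Definition floor_price prices K m : R :=
  inf (1 |` (prices `&` [set y | m%:R <= K%:R * y])).

Definition level K (y : R) : nat := Num.truncn (K%:R * y).

Definition round_policy prices K pi x := floor_price prices K (level K (pi x)).

(** * Admissible prices rounded down to finitely many values *)

Section floor_price.
Variables (prices : set R) (K : nat).
Hypothesis pc : closed prices.
Hypothesis p01 : prices `<=` `[0, 1]%classic.
Local Notation t := (floor_price prices K).
Local Notation candidates m := (1 |` (prices `&` [set y : R | m%:R <= K%:R * y])).

Let cand0 m y : candidates m y -> 0 <= y.
Proof. by move=> [->//|[/p01]]; rewrite /= in_itv/= => /andP[]. Qed.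

Let cand_lb m : has_lbound (candidates m).
Proof. by exists 0 => y /cand0. Qed.

Let cand_ne m : candidates m !=set0.
Proof. by exists 1; left. Qed.

Lemma floor_price01 m : 0 <= t m <= 1.
Proof.
by rewrite lb_le_inf//=; [exact: ge_inf (cand_lb m) _ (or_introl erefl)|move=> y /cand0].
Qed.

Lemma floor_price_le m y : prices y -> m%:R <= K%:R * y -> t m <= y.
Proof. by move=> py my; apply: ge_inf => //; right. Qed.

Lemma floor_price_nd m m' : (m <= m')%N -> t m <= t m'.
Proof.
move=> mm'; apply: lb_le_inf => // y [->|[py ky]].
  by apply: ge_inf => //; left.
by apply: floor_price_le => //; apply: le_trans ky; rewrite ler_nat.
Qed.

Lemma floor_price_mem m y : prices y -> m%:R <= K%:R * y ->
  prices (t m) /\ m%:R <= K%:R * t m.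
Proof.
move=> py my.
have cc : closed (candidates m).
  apply: closedU; first exact: accessible_closed_set1 (hausdorff_accessible (@Rhausdorff R)) _.
  apply: closedI => //; apply: (@closed_comp _ _ (fun z : R => K%:R * z) [set z | m%:R <= z]).
    by move=> z _; apply: cvgM; [exact: cvg_cst|exact: cvg_id].
  exact: closed_ge.
(* The infimum is attained. If it is the added price 1, then [1 = t m <= y <= 1], so the admissible
   price [y] is this minimum. *)
have [t1|//] := closed_inf cc (cand_ne m) (cand_lb m).
suff -> : t m = y by [].
apply/eqP; rewrite eq_le floor_price_le//=.
by have := p01 py; rewrite /t t1 /= in_itv/= => /andP[].
Qed.

End floor_price.

Section round_policy.
Variables (prices : set R) (K : nat).
Hypothesis pc : closed prices.
Hypothesis p01 : prices `<=` `[0, 1]%classic.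
Hypothesis K0 : (0 < K)%N.
Local Notation t := (floor_price prices K).
Local Notation round := (round_policy prices K).

Lemma policy01 pi x : policy D prices pi -> unit_cube D x -> 0 <= pi x <= 1.
Proof. by move=> [_ pip] /pip/p01; rewrite /= in_itv. Qed.

Lemma level_le_policy pi x : policy D prices pi -> unit_cube D x ->
  (level K (pi x))%:R <= K%:R * pi x.
Proof.
move=> ppi /(policy01 ppi)/andP[p0 _].
by rewrite truncn_le mulr_ge0.
Qed.

Lemma level_bound pi x : policy D prices pi -> unit_cube D x ->
  (level K (pi x) <= K)%N.
Proof.
move=> ppi cx; rewrite -(ler_nat R) (le_trans (level_le_policy ppi cx))//.
by rewrite ler_piMr//; have /andP[] := policy01 ppi cx.
Qed.

Lemma round_policy_le pi x : policy D prices pi -> unit_cube D x ->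
  round pi x <= pi x.
Proof.
move=> ppi cx; apply: floor_price_le => //; first by have [_ /(_ x cx)] := ppi.
exact: level_le_policy.
Qed.

Lemma round_policy_ge pi x : policy D prices pi -> unit_cube D x ->
  pi x <= round pi x + K%:R^-1.
Proof.
move=> ppi cx; have KR : 0 < K%:R :> R by rewrite ltr0n.
have [_] := floor_price_mem pc p01 (ppi.2 x cx) (level_le_policy ppi cx).
rewrite -/(round pi x) => tl; rewrite -(ler_pM2l KR) mulrDr divff ?lt0r_neq0//.
have /andP[_ /ltW] : (level K (pi x))%:R <= K%:R * pi x < (level K (pi x)).+1%:R.
  by apply: truncn_itv; have /andP[? _] := policy01 ppi cx; rewrite mulr_ge0.
by move=> /le_trans; apply; rewrite -natr1 lerD2r.
Qed.

(** Rounding composes [pi] with a nondecreasing real function, which preserves measurability; the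
    rounded values are admissible because a candidate price, [pi x] itself, exists at the level of
    [pi x]. *)
Lemma policy_round pi : policy D prices pi -> policy D prices (round pi).
Proof.
move=> ppi; split; last first.
  move=> x cx.
  by have [] := floor_price_mem pc p01 (ppi.2 x cx) (level_le_policy ppi cx).
apply: (measurableT_comp (f := fun y => t (level K y))) ppi.1.
apply: nondecreasing_measurable => // x y xy; apply: floor_price_nd => //.
by apply: le_truncn; rewrite ler_wpM2l.
Qed.

End round_policy.

(** * Infima and revenues over a feasible box *)

Section revenue.
Variable prices : set R.
Hypothesis p01 : prices `<=` `[0, 1]%classic.

Lemma box_sub_cube l u : feasible D (l, u) -> box l u `<=` unit_cube D.
Proof.
move=> [cl cu _] x [lx xu] i; have /andP[l0 _] := cl i; have /andP[_ u1] := cu i.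
by rewrite (le_trans l0 (lx i)) (le_trans (xu i) u1).
Qed.

Lemma box_left l u : feasible D (l, u) -> box l u l.
Proof. by move=> [_ _ lu]; split => // i. Qed.

Lemma inf_policy_lb pi l u x : policy D prices pi -> feasible D (l, u) ->
  box l u x -> inf (pi @` box l u) <= pi x.
Proof.
move=> ppi lu bx; apply: ge_inf; last by exists x.
by exists 0 => _ [y /(box_sub_cube lu) cy <-]; have /andP[] := policy01 p01 ppi cy.
Qed.

Lemma inf_policy_ge pi l u c : feasible D (l, u) ->
  (forall x, box l u x -> c <= pi x) -> c <= inf (pi @` box l u).
Proof.
move=> lu cpi; apply: lb_le_inf; first by exists (pi l), l => //; exact: box_left.
by move=> _ [x bx <-]; exact: cpi.
Qed.

Lemma inf_policy01 pi l u : policy D prices pi -> feasible D (l, u) ->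
  0 <= inf (pi @` box l u) <= 1.
Proof.
move=> ppi lu; apply/andP; split.
  by apply: inf_policy_ge => // x /(box_sub_cube lu) /(policy01 p01 ppi)/andP[].
apply: le_trans (inf_policy_lb ppi lu (box_left lu)) _.
by have /andP[] := policy01 p01 ppi (box_sub_cube lu (box_left lu)).
Qed.

Lemma revenue01 pi l u v : policy D prices pi -> feasible D (l, u) ->
  0 <= revenue pi l u v <= 1.
Proof.
move=> ppi lu; have /andP[i0 i1] := inf_policy01 ppi lu; rewrite /revenue.
by case: (_ <= v); rewrite ?mul1r ?mul0r ?i0 ?i1 ?lexx ?ler01.
Qed.

(* Lowering all prices by at most [e] can only turn a lost sale into a sale. *)
Lemma revenue_perturb pi pi' e l u v :
    policy D prices pi -> policy D prices pi' -> feasible D (l, u) -> 0 <= e ->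
    (forall x, unit_cube D x -> pi' x <= pi x <= pi' x + e) ->
  revenue pi l u v <= revenue pi' l u v + e.
Proof.
move=> ppi ppi' lu e0 H; have /andP[r0 _] := revenue01 v ppi' lu.
have i'i : inf (pi' @` box l u) <= inf (pi @` box l u).
  apply: inf_policy_ge => // x bx; apply: le_trans (inf_policy_lb ppi' lu bx) _.
  by have /andP[] := H x (box_sub_cube lu bx).
have ii' : inf (pi @` box l u) <= inf (pi' @` box l u) + e.
  rewrite -lerBlDr; apply: inf_policy_ge => // x bx; rewrite lerBlDr.
  apply: le_trans (inf_policy_lb ppi lu bx) _.
  by have /andP[] := H x (box_sub_cube lu bx).
rewrite {1}/revenue; case: (leP (inf (pi @` box l u)) v) => [iv|_]; last by rewrite mul0r addr_ge0.
by rewrite mul1r /revenue (le_trans i'i iv) mul1r.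
Qed.

End revenue.

(** * Minimal level over a box *)

Section min_level.
Variables (k : D.-tuple R -> nat) (K : nat).

(** The minimum of [k] over the part of the box inside the cube, capped at [K] and written as a
    count of the levels not reached. A box that misses the cube, in particular an empty one, gets
    [K]; hence the value is bounded and antitone for all boxes, including the empty ones at corners
    of cells. *)
Definition min_level l u : nat :=
  \sum_(m < K) ~~ `[< exists x, [/\ unit_cube D x, box l u x & (k x <= m)%N] >].

Lemma min_level_bound l u : (min_level l u <= K)%N.
Proof.
rewrite -[leqRHS]card_ord -sum1_card; apply: leq_sum => m _.
exact: leq_b1.
Qed.

Lemma min_level_antitone l u l' u' : box l u `<=` box l' u' ->
  (min_level l' u' <= min_level l u)%N.
Proof.
move=> bb; apply: leq_sum => m _; case: asboolP => //= h'.
by case: asboolP => // -[x [cx bx kx]]; case: h'; exists x; split => //; exact: bb.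
Qed.

Lemma min_levelP l u : feasible D (l, u) ->
    (forall x, unit_cube D x -> (k x <= K)%N) ->
  (exists2 x, box l u x & k x = min_level l u) /\
  (forall x, box l u x -> (min_level l u <= k x)%N).
Proof.
move=> lu kK; have ex_k : exists m, `[< exists2 x, box l u x & k x = m >].
  by exists (k l); apply/asboolP; exists l => //; exact: box_left.
case: (ex_minnP ex_k) => m0 /asboolP[x0 bx0 kx0] m0_min.
suff -> : min_level l u = m0.
  split; first by exists x0.
  by move=> x bx; apply: m0_min; apply/asboolP; exists x.
have m0K : (m0 <= K)%N by rewrite -kx0 kK//; exact: (box_sub_cube lu).
(* The levels counted are those below the true minimum [m0]; since [m0 <= K], the cap changes
   nothing. *)
transitivity (\sum_(m < K) (m < m0))%N.
  apply: eq_bigr => m _; congr nat_of_bool; rewrite ltnNge; congr (~~ _).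
  apply/asboolP/idP => [[x [_ bx /(leq_trans _)]]|m0m].
    by apply; apply: m0_min; apply/asboolP; exists x.
  by exists x0; split; rewrite ?kx0//; exact: (box_sub_cube lu).
have -> : (\sum_(m < K) (m < m0) = minn K m0)%N.
  elim: (K) => [|n IHn]; first by rewrite big_ord0 min0n.
  by rewrite big_ord_recr/= IHn; lia.
exact/minn_idPr.
Qed.
End min_level.

(** The minimal level is attained on the box, and the nondecreasing [floor_price] carries it to the
    minimal rounded price. *)
Lemma inf_round_policy prices K pi l u : closed prices ->
    prices `<=` `[0, 1]%classic -> policy D prices pi -> feasible D (l, u) ->
  inf (round_policy prices K pi @` box l u) =
  floor_price prices K (min_level (level K \o pi) K l u).
Proof.
move=> pc p01 ppi lu.
have [|[x0 bx0 kx0] kmin] := @min_levelP (level K \o pi) K l u lu.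
  by move=> x cx; exact: (level_bound _ p01 ppi cx).
have rp := policy_round K pc p01 ppi.
apply/eqP; rewrite eq_le; apply/andP; split.
  by rewrite -kx0; exact: (inf_policy_lb p01 rp lu bx0).
by apply: inf_policy_ge => // x bx; apply: floor_price_nd => //; exact: kmin.
Qed.

End discretisation.

(** * Cells of boxes *)

Section cells.
Context {R : realType} {D : nat} (m : nat).
Implicit Types (l u : D.-tuple R).
Local Notation M := (m.+1%:R : R).
Local Notation cells := {ffun 'I_(D + D) -> 'I_m.+1}.

(* In these coordinates a box grows when any of its coordinates grows. *)
Definition box_coord l u (i : 'I_(D + D)) : R :=
  match fintype.split i with inl j => 1 - tnth l j | inr j => tnth u j end.

(** The minimum with [m] puts [y = 1] into the last cell. *)
Definition cell_index (y : R) : nat := minn (Num.truncn (M * y)) m.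

Definition cell l u : cells := [ffun i => inord (cell_index (box_coord l u i))].

(** Together with [corner_right], the box whose coordinates in the sense of [box_coord] are [a / M].
    It is empty when opposite coordinates are too small. *)
Definition corner_left (a : 'I_(D + D) -> nat) : D.-tuple R :=
  [tuple 1 - (a (lshift D j))%:R / M | j < D].

Definition corner_right (a : 'I_(D + D) -> nat) : D.-tuple R :=
  [tuple (a (rshift D j))%:R / M | j < D].

Lemma cell_indexP y : 0 <= y <= 1 ->
  (cell_index y)%:R / M <= y <= (cell_index y).+1%:R / M.
Proof.
move=> /andP[y0 y1]; have M0 : 0 < M by rewrite ltr0n.
rewrite ler_pdivrMr// ler_pdivlMr// [y * _]mulrC /cell_index.
have /andP[t1 /ltW t2] : (Num.truncn (M * y))%:R <= M * y < (Num.truncn (M * y)).+1%:R.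
  by apply: truncn_itv; rewrite mulr_ge0.
have [tm|mt] := leqP (Num.truncn (M * y)) m; first by rewrite t1 t2.
rewrite (le_trans _ t1) ?ler_nat ?(ltnW mt)//=.
by rewrite ler_piMr.
Qed.

Lemma box_coord01 l u i : feasible D (l, u) -> 0 <= box_coord l u i <= 1.
Proof.
move=> [cl cu _]; rewrite /box_coord; case: fintype.split => j; last exact: cu.
by have /andP[? ?] := cl j; rewrite subr_ge0 gerBl; apply/andP.
Qed.

Lemma cellP l u i : feasible D (l, u) ->
  (cell l u i)%:R / M <= box_coord l u i <= (cell l u i).+1%:R / M.
Proof.
move=> lu; rewrite ffunE inordK ?ltnS ?geq_minr//.
by apply: cell_indexP; exact: box_coord01.
Qed.

Lemma box_corner_sub l u : feasible D (l, u) ->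
  box (corner_left (fun i => cell l u i)) (corner_right (fun i => cell l u i))
  `<=` box l u.
Proof.
move=> lu x [lx xu]; split => j.
  have /andP[+ _] := cellP (lshift D j) lu.
  rewrite /box_coord (unsplitK (inl j))/=; have := lx j; rewrite tnth_mktuple; move: (_ / _) => z; lra.
have /andP[+ _] := cellP (rshift D j) lu.
by rewrite /box_coord (unsplitK (inr j))/=; have := xu j; rewrite tnth_mktuple; move: (_ / _) => z; lra.
Qed.

Lemma box_sub_corner l u : feasible D (l, u) ->
  box l u `<=` box (corner_left (fun i => (cell l u i).+1))
                   (corner_right (fun i => (cell l u i).+1)).
Proof.
move=> lu x [lx xu]; split => j; rewrite tnth_mktuple.
  have /andP[_] := cellP (lshift D j) lu.
  by rewrite /box_coord (unsplitK (inl j))/=; have := lx j; move: (_ / _) => z; lra.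
have /andP[_] := cellP (rshift D j) lu.
by rewrite /box_coord (unsplitK (inr j))/=; have := xu j; move: (_ / _) => z; lra.
Qed.

Section jump_cells.
Variables (k : D.-tuple R -> nat) (K : nat).

Definition corner_level (a : 'I_(D + D) -> nat) : nat :=
  min_level k K (corner_left a) (corner_right a).

Definition jump_cell (a : cells) : bool :=
  corner_level (fun i => a i) != corner_level (fun i => (a i).+1).

(** Larger corner coordinates give larger boxes, so [corner_level] is antitone and bounded by [K],
    as [card_jump] requires. *)
Lemma card_jump_cell :
  (#|jump_cell| <= K * ((D + D) * m.+1 ^ (D + D).-1))%N.
Proof.
apply: card_jump => [a b ab|a]; last exact: min_level_bound.
apply: min_level_antitone => x [ax xa]; split => j.
  apply: le_trans (ax j); rewrite !tnth_mktuple lerB// ler_pM2r ?invr_gt0 ?ltr0n//.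
  by rewrite ler_nat.
apply: le_trans (xa j) _; rewrite !tnth_mktuple ler_pM2r ?invr_gt0 ?ltr0n//.
by rewrite ler_nat.
Qed.

(** A box lies between the boxes at the two extreme corners of its cell; without a jump the two
    resulting bounds on the antitone [min_level] coincide. *)
Lemma min_level_cell l u : feasible D (l, u) -> ~~ jump_cell (cell l u) ->
  min_level k K l u = corner_level (fun i => cell l u i).
Proof.
move=> lu /negPn/eqP jc; apply/eqP; rewrite eqn_leq; apply/andP; split.
  by apply: min_level_antitone; exact: box_corner_sub.
by rewrite jc; apply: min_level_antitone; exact: box_sub_corner.
Qed.

End jump_cells.

(** The closed cell in the coordinates [(l, u)] of the density, with the first [D] sides reflected.
    Neighbouring cells share faces, which is harmless in a union bound. *)
Definition cell_box (a : cells) : set ((D + D).-tuple R) :=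
  [set t | forall i, (match fintype.split i with
     | inl _ => `[1 - (a i).+1%:R / M, 1 - (a i)%:R / M]%classic
     | inr _ => `[(a i)%:R / M, (a i).+1%:R / M]%classic end : set R) (tnth t i)].

Lemma cell_box_cell l u : feasible D (l, u) -> cell_box (cell l u) (cat_tuple l u).
Proof.
move=> lu i; have := cellP i lu; rewrite /box_coord.
case: (split_ordP i) => j ->.
  by rewrite /= in_itv/= tnth_lshift; move: (_ / _) (_ / _) => z z'; lra.
by rewrite /= in_itv/= tnth_rshift.
Qed.

Lemma measurable_coord n (A : 'I_n -> set R) : (forall i, measurable (A i)) ->
  measurable [set t : n.-tuple R | forall i, A i (tnth t i)].
Proof.
move=> mA; rewrite (_ : [set _ | _] = \bigcap_(i in [set: 'I_n])
    ((fun t : n.-tuple R => tnth t i) @^-1` A i)).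
  apply: fin_bigcap_measurable => // i _.
  by rewrite -[X in measurable X]setTI; exact: measurable_tnth.
by apply/seteqP; split => t /= At i; [move=> _; exact: At|exact: (At i I)].
Qed.

Let side (a : cells) i : set R := match fintype.split i with
  | inl _ => `[1 - (a i).+1%:R / M, 1 - (a i)%:R / M]%classic
  | inr _ => `[(a i)%:R / M, (a i).+1%:R / M]%classic end.

Let measurable_side a i : measurable (side a i).
Proof. by rewrite /side; case: fintype.split => _; exact: measurable_itv. Qed.

Lemma measurable_cell_box a : measurable (cell_box a).
Proof. exact: measurable_coord (measurable_side a). Qed.

Lemma lebesgue_cell_box a : lebesgue_tuple _ (cell_box a) = (M ^- (D + D))%:E.
Proof.
rewrite (lebesgue_tuple_box (measurable_side a)) (eq_bigr (fun=> (M^-1)%:E)).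
  by rewrite prodEFin prodr_const card_ord exprVn.
move=> i _; have M0 : 0 < M^-1 by rewrite invr_gt0 ltr0n.
have aM : (a i).+1%:R / M = (a i)%:R / M + M^-1 by rewrite -natr1 mulrDl mul1r.
rewrite /side; case: fintype.split => j; rewrite lebesgue_measure_itv/= aM.
  by rewrite lte_fin ltrD2l ltrN2 ltrDl M0 -EFinB; congr EFin; ring.
by rewrite lte_fin ltrDl M0 -EFinB; congr EFin; ring.
Qed.

End cells.

(** * Empirical means and lower integrals *)

Section discrepancy.
Context d (T : measurableType d) (R : realType) (Q : probability T R).
Context d' (S : measurableType d') (Z : nat -> T -> S).
Hypothesis mZ : forall i, measurable_fun setT (Z i).
Hypothesis Zident : forall i A, measurable A -> Q (Z i @^-1` A) = Q (Z 0 @^-1` A).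
Hypothesis Zindep : forall i j A, i != j -> measurable A ->
  Q (Z i @^-1` A `&` Z j @^-1` A) = (Q (Z i @^-1` A) * Q (Z j @^-1` A))%E.
Context (I : finType) (F : I -> set S).
Hypothesis mF : forall x, measurable (F x).

Lemma measurable_preimage i A : measurable A -> measurable (Z i @^-1` A).
Proof. by move=> mA; rewrite -[X in measurable X]setTI; exact: mZ. Qed.

Definition empirical_mean N w (f : S -> R) : R :=
  N%:R^-1 * \sum_(1 <= i < N.+1) f (Z i w).

Definition law x : R := prob Q (Z 0 @^-1` F x).

Definition discrepancy N w : R :=
  \sum_x `|empirical_mean N w \1_(F x) - law x|.

Lemma cvg_discrepancy : {ae Q, forall w, discrepancy N w @[N --> \oo] --> 0}.
Proof.
have cvgF x : {ae Q, forall w, empirical_mean N w \1_(F x) @[N --> \oo] --> law x}.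
  apply: (strong_law_events (E := fun i => Z i @^-1` F x)) => [i|i|i j ij].
  - exact: measurable_preimage.
  - by rewrite Zident//; apply: probE; exact: measurable_preimage.
  - rewrite Zindep// !Zident// EFinM /law.
    by congr (_ * _)%E; apply: probE; exact: measurable_preimage.
have := filter_forall (ae_filter_ringOfSetsType Q) cvgF.
apply: filterS => w cvgw; rewrite /discrepancy; elim: (index_enum I) => [|x r IHr].
  by under eq_fun do rewrite big_nil; exact: cvg_cst.
under eq_fun do rewrite big_cons.
have cvg0 : `|empirical_mean N w \1_(F x) - law x| @[N --> \oo] --> 0.
  by rewrite -(normr0 R) -(subrr (law x)); apply: cvg_norm; apply: cvgB (cvgw x) (cvg_cst _).
have := cvgD cvg0 IHr; rewrite addr0 => cvgs; exact: cvgs.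
Qed.

(** The right-hand side does not involve [c]: this uniformity lets one null set serve all
    policies. *)
Lemma empirical_mean_combination N w (c : I -> R) : (forall x, 0 <= c x <= 1) ->
  `|empirical_mean N w (fun z => \sum_x c x * \1_(F x) z) - \sum_x c x * law x|
  <= discrepancy N w.
Proof.
move=> c01; rewrite /empirical_mean exchange_big/= big_distrr/= -sumrB.
apply: le_trans (ler_norm_sum _ _ _) _; apply: ler_sum => x _.
rewrite -big_distrr/= mulrCA -mulrBr normrM; have /andP[c0 c1] := c01 x.
by rewrite ger0_norm// ler_piMl.
Qed.

Lemma integral_combination (c : I -> R) :
  (\int[Q]_w (\sum_x c x * \1_(F x) (Z 0%N w))%:E = (\sum_x c x * law x)%:E)%E.
Proof.
rewrite -(integral_sum_indic Q c (A := fun x => Z 0 @^-1` F x)) => [|x].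
  by apply: eq_integral => w _; congr EFin; apply: eq_bigr.
exact: measurable_preimage.
Qed.

End discrepancy.

(* The integral of a nonmeasurable function is the difference of the lower integrals
   of its positive and negative parts; it is still monotone. *)
Section lower_integral.
Context d (T : measurableType d) (R : realType) (mu : {measure set T -> \bar R}).
Local Open Scope ereal_scope.

Lemma ge0_le_integral_nonmeasurable (f g : T -> \bar R) :
  (forall x, 0 <= f x) -> (forall x, f x <= g x) -> \int[mu]_x f x <= \int[mu]_x g x.
Proof.
move=> f0 fg; rewrite !ge0_integralTE// => [|x]; last exact: le_trans (f0 x) (fg x).
apply: ge_ereal_sup => _ [h /= hf <-]; apply: ereal_sup_ubound; exists h => //= x.
exact: le_trans (hf x) (fg x).
Qed.

(** Adding [+oo] to [h] on the exceptional null set makes the bound hold everywhere and leaves the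
    integral of [h] unchanged, so that monotonicity applies to an arbitrary [f]. *)
Lemma ae_le_integral_ub (f h : T -> \bar R) : measurable_fun setT h ->
  (forall x, 0 <= h x) -> {ae mu, forall x, f x <= h x} ->
  \int[mu]_x f x <= \int[mu]_x h x.
Proof.
move=> mh h0 [N [mN N0 fhN]]; pose h' x := h x + (cst +oo \_ N) x.
have oo0 x : 0 <= (cst +oo \_ N : T -> \bar R) x.
  by rewrite patchE; case: ifP => // _; exact: leey.
have -> : \int[mu]_x h x = \int[mu]_x h' x.
  apply: ge0_ae_eq_integral => //.
  - by apply: emeasurable_funD => //; apply/(measurable_restrictT _ mN); exact: measurable_cst.
  - by move=> x _; rewrite adde_ge0.
  - exists N; split => // x /= /not_implyP[_]; apply: contra_notP => Nx.
    by rewrite /h' patchE memNset// adde0.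
rewrite integralE; apply: (@le_trans _ _ (\int[mu]_x f^\+ x)).
  by rewrite -[leRHS]sube0 leeB// integral_ge0.
apply: ge0_le_integral_nonmeasurable => // x; rewrite funeposE ge_max adde_ge0// andbT.
rewrite /h' patchE; case: ifPn => [_|/negP xN].
  by rewrite addey ?leey// gt_eqF// (lt_le_trans _ (h0 x)).
rewrite adde0; apply: contrapT => fh; apply: xN; rewrite inE; apply: fhN => /=.
exact: fh.
Qed.

(** The negative part of [f] lives on the exceptional null set and integrates to 0; off that set [h]
    is below the positive part. *)
Lemma ae_le_integral_lb (f h : T -> \bar R) : measurable_fun setT h ->
  (forall x, 0 <= h x) -> {ae mu, forall x, h x <= f x} ->
  \int[mu]_x h x <= \int[mu]_x f x.
Proof.
move=> mh h0 [N [mN N0 hfN]].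
have hf x : ~ N x -> h x <= f x.
  by move=> Nx; apply: contrapT => ?; apply: Nx; exact: hfN.
have oo0 x : 0 <= (cst +oo \_ N : T -> \bar R) x.
  by rewrite patchE; case: ifP => // _; exact: leey.
have f0 : \int[mu]_x f^\- x = 0.
  apply/eqP; rewrite eq_le integral_ge0// andbT.
  apply: (@le_trans _ _ (\int[mu]_x (cst +oo \_ N) x)).
    apply: ge0_le_integral_nonmeasurable => // x; rewrite funenegE patchE.
    case: ifPn => [_|]; first exact: leey.
    rewrite notin_setE => /hf hfx; rewrite ge_max lexx andbT leeNl oppe0.
    exact: le_trans (h0 x) hfx.
  by rewrite -integral_mkcond integral_cst// N0 mule0.
rewrite (integralE _ _ f) f0 sube0.
rewrite (@ge0_ae_eq_integral _ _ _ mu setT h (h \_ ~` N))//.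
- apply: ge0_le_integral_nonmeasurable => [x|x].
    by rewrite patchE; case: ifP.
  rewrite patchE funeposE; case: ifPn => [|_]; last by rewrite le_max lexx orbT.
  by rewrite inE => /hf hfx; rewrite le_max hfx.
- apply/(measurable_restrictT _ (measurableC mN)); exact: measurable_funTS.
- by move=> x _; rewrite patchE; case: ifP.
- exists N; split => // x /= /not_implyP[_]; apply: contra_notP => Nx.
  by rewrite patchE mem_set.
Qed.

End lower_integral.

(** * Sandwiching the revenue *)

Section sandwich.
Context {R : realType} {D : nat} (prices : set R) (m K : nat).
Hypothesis pc : closed prices.
Hypothesis p01 : prices `<=` `[0, 1]%classic.
Local Notation S := (D.-tuple R * D.-tuple R * R)%type.
Local Notation cells := {ffun 'I_(D + D) -> 'I_m.+1}.
Local Notation t := (floor_price prices K).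
Implicit Types (k : D.-tuple R -> nat) (z : S).

Definition cell_event (a : cells) : set S := [set z | cell m z.1.1 z.1.2 = a].

(** A finite family independent of the policy. The bare cells [inr a] serve to bound the revenue by
    1 on jump cells. *)
Definition event (x : cells * 'I_K.+1 + cells) : set S := match x with
  | inl (a, n) => cell_event a `&` [set z | t n <= z.2]
  | inr a => cell_event a
  end.

(** On a cell without jump the rounded policy earns [t n] if [t n <= v] and nothing otherwise, where
    [n] is the constant minimal level. On jump cells the lower bound is 0. *)
Definition low_coef k (x : cells * 'I_K.+1 + cells) : R := match x with
  | inl (a, n) => (~~ jump_cell k K a && (n == corner_level m k K (fun i => a i) :> nat))%:R * t n
  | inr _ => 0
  end.

Definition up_coef k (x : cells * 'I_K.+1 + cells) : R := match x with
  | inl _ => low_coef k x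
  | inr a => (jump_cell k K a)%:R
  end.

Lemma low_coef01 k x : 0 <= low_coef k x <= 1.
Proof.
case: x => [[a n]|a] /=; last by rewrite lexx ler01.
have /andP[t0 t1] := floor_price01 K p01 n.
by case: (~~ _ && _); rewrite ?mul0r ?mul1r ?lexx ?ler01 ?t0 ?t1.
Qed.

Lemma up_coef01 k x : 0 <= up_coef k x <= 1.
Proof.
case: x => [x|a]; first exact: low_coef01.
by rewrite /= ler0n lern1 leq_b1.
Qed.

(** Only the index formed by the cell of [z] and its corner level can contribute; this level is at
    most [K], hence a valid index. *)
Lemma low_combination k z (a := cell m z.1.1 z.1.2)
    (p := t (corner_level m k K (fun i => a i))) :
  \sum_x low_coef k x * \1_(event x) z = (~~ jump_cell k K a)%:R * ((p <= z.2)%R%:R * p).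
Proof.
pose n : 'I_K.+1 := inord (corner_level m k K (fun i => a i)).
have nE : n = corner_level m k K (fun i => a i) :> nat.
  by rewrite /n inordK// ltnS min_level_bound.
rewrite big_sumType/= [X in _ + X]big1 ?addr0 => [|b _]; last by rewrite mul0r.
rewrite (bigD1 (a, n))//= big1 ?addr0 => [|[b n'] ban /=].
  rewrite nE eqxx andbT indicE -mulrA; congr (_ * _); rewrite -/p mulrC; congr (_%:R * _).
  have pE : p = t n by rewrite nE.
  congr nat_of_bool; apply/idP/idP => [/set_mem[_]|pz]; first by rewrite pE.
  by apply/mem_set; split => //; rewrite -[t n]pE.
rewrite indicE; have [/set_mem[/= ab _]|_] := boolP (z \in _); last by rewrite mulr0.
rewrite -ab -/a; case: eqP => [n'E|_]; last by rewrite andbF !mul0r.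
case/eqP: ban; congr pair; first by rewrite -ab.
by apply/val_inj; rewrite /= n'E nE.
Qed.

Lemma up_combination k z :
  \sum_x up_coef k x * \1_(event x) z =
  \sum_x low_coef k x * \1_(event x) z + (jump_cell k K (cell m z.1.1 z.1.2))%:R.
Proof.
rewrite !big_sumType/= -addrA; congr (_ + _).
rewrite [X in _ = X + _]big1 ?add0r => [|b _]; last by rewrite mul0r.
rewrite (bigD1 (cell m z.1.1 z.1.2))//= indicE mem_set// mulr1 big1 ?addr0// => b bz.
by rewrite indicE memNset ?mulr0//=; move/eqP: bz => bz zb; apply: bz.
Qed.

Lemma revenue_sandwich pi z (k := level K \o pi) :
    policy D prices pi -> (feasible D `*` `[0, 1]%classic) z ->
  \sum_x low_coef k x * \1_(event x) z <=
    revenue (round_policy prices K pi) z.1.1 z.1.2 z.2 <=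
  \sum_x up_coef k x * \1_(event x) z.
Proof.
move=> ppi [zf _]; have lu : feasible D (z.1.1, z.1.2) by rewrite -surjective_pairing.
rewrite up_combination low_combination.
have /andP[r0 r1] := revenue01 p01 z.2 (policy_round K pc p01 ppi) lu.
have [jz|jz] := boolP (jump_cell _ _ _); first by rewrite !mul0r r0 add0r.
rewrite !mul1r addr0 /revenue inf_round_policy// -/k.
by rewrite (min_level_cell lu jz) lexx.
Qed.

(** A cell index is a nondecreasing function of one coordinate, hence measurable. *)
Lemma measurable_event x : measurable (event x).
Proof.
have mbox i : measurable_fun setT (fun z : S => box_coord z.1.1 z.1.2 i).
  have m11 : measurable_fun setT (fun z : S => z.1.1).
    by apply: measurableT_comp; [exact: measurable_fst|exact: measurable_fst].
  have m12 : measurable_fun setT (fun z : S => z.1.2).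
    by apply: measurableT_comp; [exact: measurable_snd|exact: measurable_fst].
  rewrite /box_coord; case: fintype.split => j; last first.
    exact: measurableT_comp (measurable_tnth j) m12.
  apply: measurable_funB => //.
  exact: measurableT_comp (measurable_tnth j) m11.
have mcell a : measurable (cell_event a).
  pose f i (z : S) : R := (cell_index m (box_coord z.1.1 z.1.2 i))%:R.
  have mf i : measurable_fun setT (f i).
    apply: (measurableT_comp (f := fun y => (cell_index m y)%:R : R)) (mbox i).
    apply: nondecreasing_measurable => // y y' yy'; rewrite ler_nat /cell_index.
    rewrite leq_min geq_minr andbT (leq_trans (geq_minl _ _))// le_truncn//.
    by rewrite ler_wpM2l.
  rewrite (_ : cell_event a = \bigcap_(i in [set: 'I_(D + D)]) (f i @^-1` [set (a i)%:R])).
    apply: fin_bigcap_measurable => // i _.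
    by rewrite -[X in measurable X]setTI; apply: mf => //; exact: measurable_set1.
  apply/seteqP; split => z /=.
    by move=> <- i _; rewrite /f/= ffunE inordK// ltnS geq_minr.
  move=> fz; apply/ffunP => i; rewrite ffunE; apply/val_inj.
  rewrite /= inordK ?ltnS ?geq_minr//; apply/eqP; rewrite -(eqr_nat R).
  exact/eqP/(fz i I).
case: x => [[a n]|a]; last exact: mcell.
rewrite (_ : event _ = cell_event a `&`
  ((fun z : S => z.2) @^-1` `[t n, +oo[%classic)).
  apply: measurableI => //; rewrite -[X in measurable X]setTI.
  by apply: measurable_snd => //; exact: measurable_itv.
by apply/seteqP; split=> z /=; rewrite in_itv/= andbT.
Qed.

End sandwich.

(** * Convergence of the sample value *)

Section consistency.
Context d (T : measurableType d) (R : realType) (Q : probability T R) (D : nat).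
Variables (prices : set R) (L U : nat -> T -> D.-tuple R) (V : nat -> T -> R).
Hypothesis D0 : (0 < D)%N.
Hypothesis pc : closed prices.
Hypothesis pne : prices !=set0.
Hypothesis p01 : prices `<=` `[0, 1]%classic.
Hypothesis mL : forall i, measurable_fun setT (L i).
Hypothesis mU : forall i, measurable_fun setT (U i).
Hypothesis mV : forall i, measurable_fun setT (V i).
Let Z i w := (L i w, U i w, V i w).
Hypothesis Zident : forall i A, measurable A -> Q (Z i @^-1` A) = Q (Z 0 @^-1` A).
Hypothesis Zindep : forall i j A, i != j -> measurable A ->
  Q (Z i @^-1` A `&` Z j @^-1` A) = (Q (Z i @^-1` A) * Q (Z j @^-1` A))%E.
Hypothesis Zfeasible : forall i,
  {ae Q, forall w, (feasible D `*` `[0, 1]%classic) (Z i w)}.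
Hypothesis LU_ac : forall e : R, 0 < e -> exists2 del : R, 0 < del &
  forall A, measurable A -> (lebesgue_tuple (D + D) A <= del%:E)%E ->
    (Q ((fun w => cat_tuple (L 0%N w) (U 0%N w)) @^-1` A) <= e%:E)%E.

Let measurable_Z i : measurable_fun setT (Z i).
Proof. by apply: measurable_fun_pair => //; exact: measurable_fun_pair. Qed.

Let mean N w (pi : D.-tuple R -> R) : R :=
  empirical_mean Z N w (fun z => revenue pi z.1.1 z.1.2 z.2).

Let value : \bar R :=
  ereal_sup [set 'E_Q[fun w => revenue pi (L 0%N w) (U 0%N w) (V 0%N w)]
            | pi in policy D prices]%E.

Let measurable_combination (I : finType) (c : I -> R)
    (F : I -> set (D.-tuple R * D.-tuple R * R)%type) :
  (forall x, measurable (F x)) ->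
  measurable_fun setT (fun w => \sum_x c x * \1_(F x) (Z 0%N w)).
Proof.
move=> mF; apply: measurable_sum => x; apply: measurable_funM => //.
exact: measurableT_comp (measurable_indic (mF x)) (measurable_Z 0).
Qed.

(** The grid is chosen before [k]: the number of jump cells is bounded through [K] alone, and
    absolute continuity turns their small total volume into small probability. *)
Lemma jump_cell_small K (e : R) : 0 < e -> exists m, forall k : D.-tuple R -> nat,
  \sum_a (jump_cell (m := m) k K a)%:R * law Q Z (cell_event (m := m)) a <= e.
Proof.
move=> e0; have [del del0 ac] := LU_ac e0.
(* At most [c M^(2D - 1)] jump cells of volume [M^(- 2D)] each have total volume at most [c / M],
   and [M > c / del]. *)
pose c : R := (K * (D + D))%:R.
exists (Num.truncn (c / del)) => k; set m := Num.truncn _.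
have cm : c / m.+1%:R <= del.
  rewrite ler_pdivrMr ?ltr0n// mulrC -ler_pdivrMr//.
  exact/ltW/truncnS_gt.
pose A : set ((D + D).-tuple R) := \big[setU/set0]_(a | jump_cell (m := m) k K a) cell_box a.
have [mA lA] : measurable A /\
    (lebesgue_tuple (D + D) A <= (\sum_(a | jump_cell (m := m) k K a) (m.+1%:R ^- (D + D))%:E))%E.
  rewrite /A; apply: (big_ind2 (fun B s => measurable B /\ (lebesgue_tuple (D + D) B <= s)%E)).
  - by rewrite measure0.
  - move=> B s B' s' [mB Bs] [mB' Bs']; split; first exact: measurableU.
    by apply: (le_trans (measureU2 _ mB mB')); exact: leeD.
  - by move=> a _; rewrite lebesgue_cell_box; split => //; exact: measurable_cell_box.
have {}lA : (lebesgue_tuple (D + D) A <= del%:E)%E.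
  apply: (le_trans lA); rewrite sumEFin lee_fin sumr_const -[_ *+ #|_|]mulr_natl.
  apply: le_trans cm; have M0 : 0 < m.+1%:R :> R by rewrite ltr0n.
  rewrite ler_pdivrMr ?exprn_gt0// mulrAC ler_pdivlMr//.
  rewrite /c -natrX -!natrM ler_nat.
  rewrite (leq_trans (leq_mul (card_jump_cell _ _ _) (leqnn _)))//.
  have -> : (m.+1 ^ (D + D) = m.+1 ^ (D + D).-1 * m.+1)%N by rewrite -expnSr prednK// addn_gt0 D0.
  by rewrite !mulnA.
have mevent (a : {ffun 'I_(D + D) -> 'I_m.+1}) : measurable (@cell_event R D m a).
  exact: (@measurable_event R D prices m 0 (inr a)).
rewrite -lee_fin -(integral_combination Q measurable_Z mevent).
have mX : measurable ((fun w => cat_tuple (L 0%N w) (U 0%N w)) @^-1` A).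
  by rewrite -[X in measurable X]setTI; exact: measurable_cat_tuple.
apply: le_trans (ac A mA lA).
rewrite -[X in (_ <= Q X)%E]setIT -[leRHS]integral_indic//.
(* For feasible [(L, U)] only the term of its own cell survives, and if that cell is a jump cell
   then [(L, U)] lies in [A]. *)
apply: ae_le_integral_ub.
- by apply/measurable_EFinP; exact: measurable_indic.
- by move=> w; rewrite lee_fin.
apply: filterS (Zfeasible 0) => w [/= lu _]; rewrite lee_fin.
rewrite (bigD1 (cell m (L 0%N w) (U 0%N w)))//= [X in _ + X]big1 ?addr0 => [|a aw].
  rewrite [X in _ * X]indicE mem_set// mulr1.
  case: (boolP (jump_cell _ _ _)) => // jw; rewrite indicE mem_set//=.
  by rewrite /A (bigD1 (cell m (L 0%N w) (U 0%N w)))//=; left; exact: cell_box_cell.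
rewrite indicE memNset ?mulr0// => /= aw'; move/eqP: aw; apply.
by rewrite -aw'.
Qed.

Let mean_le N w (f h : D.-tuple R * D.-tuple R * R -> R) (c : R) : 0 <= c ->
    (forall i, f (Z i w) <= h (Z i w) + c) ->
  empirical_mean Z N w f <= empirical_mean Z N w h + c.
Proof.
move=> c0 fh; rewrite /empirical_mean.
(* Only an inequality, because at [N = 0] the mean is 0. *)
have cN : N%:R^-1 * \sum_(1 <= i < N.+1) c <= c.
  rewrite sumr_const_nat subn1/= -[c *+ N]mulr_natl mulrA ler_piMl//.
  by case: N => [|N]; rewrite ?mulr0// mulVf// pnatr_eq0.
rewrite -lerBlDl; apply: le_trans cN; rewrite -mulrBr -sumrB.
rewrite ler_wpM2l ?invr_ge0//; apply: ler_sum => i _.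
by rewrite lerBlDl.
Qed.

Lemma value_fin_num : value \is a fin_num.
Proof.
have value_ge0 : (0 <= value)%E.
  have [c pcc] := pne; have pol : policy D prices (cst c) by split.
  apply: le_trans (ereal_sup_ubound _); last by exists (cst c).
  rewrite unlock -[leLHS](integral0 Q setT).
  apply: ae_le_integral_lb => //; apply: filterS (Zfeasible 0) => w [/= lu _].
  by rewrite lee_fin; have /andP[] := revenue01 p01 (V 0%N w) pol lu.
have value_le1 : (value <= 1)%E.
  apply: ge_ereal_sup => _ [pi pol <-]; rewrite unlock.
  apply: (@le_trans _ _ (\int[Q]_w (cst 1 w))%E).
    apply: ae_le_integral_ub => //; apply: filterS (Zfeasible 0) => w [/= lu _].
    by rewrite lee_fin; have /andP[] := revenue01 p01 (V 0%N w) pol lu.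
  by rewrite integral_cst// mul1e; exact: probability_le1.
by rewrite ge0_fin_numE// (le_lt_trans value_le1)// ltry.
Qed.

Lemma sample_value_near (e : R) : 0 < e -> {ae Q, forall w, \forall N \near \oo,
  (value - e%:E <= nu_hat prices L U V N w <= value + e%:E)%E}.
Proof.
(* One third of [e] each pays for rounding the prices, for the jump cells and for the
   discrepancy. *)
move=> e0; have e30 : 0 < e / 3 by rewrite divr_gt0.
pose K := (Num.truncn (3 / e)).+1; have K0 : (0 < K)%N by [].
have Ke : K%:R^-1 <= e / 3.
  rewrite -[leRHS]invrK lef_pV2 ?posrE ?ltr0n ?invr_gt0// invf_div.
  exact/ltW/truncnS_gt.
have [m jm] := jump_cell_small K e30.
pose F := @event R D prices m K.
have mF x : measurable (F x) by exact: measurable_event.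
pose low (pi : D.-tuple R -> R) := \sum_x low_coef prices (level K \o pi) x * law Q Z F x.
pose up (pi : D.-tuple R -> R) := \sum_x up_coef prices (level K \o pi) x * law Q Z F x.
have up_low pi : up pi <= low pi + e / 3.
  rewrite /up /low !big_sumType/= [X in _ + X + _]big1 ?addr0 => [|a _]; last by rewrite mul0r.
  by rewrite lerD2l; exact: jm.
have low_value pi : policy D prices pi -> ((low pi)%:E <= value)%E.
  move=> pol; apply: le_trans (ereal_sup_ubound _); last first.
    by exists (round_policy prices K pi) => //; exact: policy_round.
  rewrite unlock -(integral_combination Q measurable_Z mF).
  apply: ae_le_integral_lb.
  - by apply/measurable_EFinP; exact: measurable_combination.
  - move=> w; rewrite lee_fin sumr_ge0// => x _; rewrite mulr_ge0//.
    by have /andP[] := low_coef01 p01 (level K \o pi) x.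
  - apply: filterS (Zfeasible 0) => w Zw; rewrite lee_fin.
    by have /andP[] := revenue_sandwich m K pc p01 pol Zw.
have value_up pi : policy D prices pi ->
    ('E_Q[fun w => revenue pi (L 0%N w) (U 0%N w) (V 0%N w)] <= (up pi + e / 3)%:E)%E.
  move=> pol; rewrite unlock EFinD -(integral_combination Q measurable_Z mF).
  have upw0 w : 0 <= \sum_x up_coef prices (level K \o pi) x * \1_(F x) (Z 0 w).
    rewrite sumr_ge0// => x _; rewrite mulr_ge0//.
    by have /andP[] := up_coef01 p01 (level K \o pi) x.
  rewrite -[X in (_ <= _ + X)%E]mule1 -(probability_setT Q) -integral_cst//.
  rewrite -ge0_integralD//; last 3 first.
  - by move=> w _; rewrite lee_fin.
  - by apply/measurable_EFinP; exact: measurable_combination.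
  - by move=> w _; rewrite lee_fin ltW.
  apply: ae_le_integral_ub.
  - apply: emeasurable_funD => //.
    by apply/measurable_EFinP; exact: measurable_combination.
  - by move=> w; rewrite -EFinD lee_fin addr_ge0// ltW.
  - apply: filterS (Zfeasible 0) => w Zw; rewrite -EFinD lee_fin.
    have /andP[_] := revenue_sandwich m K pc p01 pol Zw.
    rewrite -(lerD2r (e / 3)); apply: le_trans.
    apply: (revenue_perturb p01 _ pol (policy_round K pc p01 pol) Zw.1 (ltW e30)) => x cx.
    rewrite round_policy_le//= (le_trans (round_policy_ge pc p01 K0 pol cx))// lerD2l.
    exact: Ke.
have : {ae Q, forall w, forall i, (feasible D `*` `[0, 1]%classic) (Z i w)}.
  exact: ae_foralln.
have := cvg_discrepancy measurable_Z Zident Zindep mF.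
apply: filterS2 => w /cvgrPdist_le/(_ _ e30) disc Zw.
apply: filterS disc => N; rewrite sub0r normrN ger0_norm ?sumr_ge0// => disc.
have mean_comb c : (forall x, 0 <= c x <= 1) ->
    `|empirical_mean Z N w (fun z => \sum_x c x * \1_(F x) z) - \sum_x c x * law Q Z F x|
    <= e / 3.
  by move=> c01; apply: le_trans disc; exact: empirical_mean_combination.
have low_mean pi : policy D prices pi -> low pi <= mean N w (round_policy prices K pi) + e / 3.
  move=> pol.
  have := mean_comb _ (low_coef01 p01 (level K \o pi)).
  rewrite ler_norml => /andP[+ _]; rewrite -/(low pi) => h1.
  have : empirical_mean Z N w (fun z => \sum_x low_coef prices (level K \o pi) x * \1_(F x) z)
      <= mean N w (round_policy prices K pi) + 0.
    apply: mean_le => // i; rewrite addr0.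
    by have /andP[] := revenue_sandwich m K pc p01 pol (Zw i).
  by rewrite addr0; lra.
have mean_up pi : policy D prices pi -> mean N w pi <= up pi + e / 3 + e / 3.
  move=> pol.
  have := mean_comb _ (up_coef01 p01 (level K \o pi)).
  rewrite ler_norml => /andP[_]; rewrite -/(up pi) => h1.
  have : mean N w pi <= empirical_mean Z N w
      (fun z => \sum_x up_coef prices (level K \o pi) x * \1_(F x) z) + e / 3.
    apply: mean_le => [|i]; first exact: ltW.
    have /andP[_] := revenue_sandwich m K pc p01 pol (Zw i).
    rewrite -(lerD2r (e / 3)); apply: le_trans.
    apply: (revenue_perturb p01 _ pol (policy_round K pc p01 pol) (Zw i).1 (ltW e30)) => x cx.
    rewrite round_policy_le//= (le_trans (round_policy_ge pc p01 K0 pol cx))// lerD2l.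
    exact: Ke.
  lra.
apply/andP; split.
  (* The rounded policy competes in the sample problem, and its sample mean plus [e] bounds the
     expected revenue of [pi]. *)
  rewrite leeBlDr//; apply: ge_ereal_sup => _ [pi pol <-].
  apply: le_trans (value_up pi pol) _.
  apply: (@le_trans _ _ ((mean N w (round_policy prices K pi))%:E + e%:E)%E).
    rewrite -EFinD lee_fin; have := up_low pi; have := low_mean pi pol; lra.
  rewrite leeD2r//; apply: ereal_sup_ubound.
  by exists (round_policy prices K pi) => //; exact: policy_round.
(* Conversely, the sample mean of [pi] is at most [low pi + e], and [low pi] is at most the expected
   revenue of the rounded policy. *)
apply: ge_ereal_sup => _ [pi pol <-].
apply: (@le_trans _ _ ((low pi)%:E + e%:E)%E); last by rewrite leeD2r// low_value.
rewrite -EFinD lee_fin.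
by have := mean_up pi pol; rewrite /mean /empirical_mean/=; have := up_low pi; lra.
Qed.

Lemma cvg_sample_value :
  {ae Q, forall w, nu_hat prices L U V N w @[N --> \oo] --> value}.
Proof.
(* Restricting the tolerance to [1 / (n + 1)] leaves countably many null sets to discard. *)
have : {ae Q, forall w, forall n : nat, \forall N \near \oo,
    (value - (n.+1%:R^-1)%:E <= nu_hat prices L U V N w <= value + (n.+1%:R^-1)%:E)%E}.
  by apply: ae_foralln => n; apply: sample_value_near; rewrite invr_gt0.
apply: filterS => w; rewrite -(fineK value_fin_num); set s := fine value => near_s.
apply/fine_cvgP; split.
  (* Tolerance 1 already makes the sample values eventually finite. *)
  apply: filterS (near_s 0%N) => N /andP[sl su].
  by rewrite fin_numElt (lt_le_trans _ sl) ?(le_lt_trans su)// -?EFinD -?EFinB ?ltry ?ltNyr.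
apply/cvgrPdist_le => e e0; pose n := Num.truncn e^-1.
have ne : n.+1%:R^-1 <= e.
  by rewrite -[leRHS]invrK lef_pV2 ?posrE ?invr_gt0//; exact/ltW/truncnS_gt.
apply: filterS (near_s n) => N /=; case: (nu_hat _ _ _ _ _ _) => [r| |]/=.
- rewrite -EFinB -EFinD !lee_fin ler_norml; move: (n.+1%:R^-1) ne => z ze /andP[sl su].
  by apply/andP; split; lra.
- by rewrite -EFinD leye_eq andbF.
- by [].
Qed.

End consistency.

(** * Support and completion *)

Section support.
Context d (T : measurableType d) (R : realType) (P : probability T R).

Lemma measurable_cube_nbhd n (x : n.-tuple R) e : measurable (cube_nbhd x e).
Proof.
apply: (measurable_coord (A := fun i => [set y | `|tnth x i - y| < e])) => i.
rewrite (_ : [set _ | _] = `]tnth x i - e, tnth x i + e[%classic).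
  exact: measurable_itv.
by apply/seteqP; split => y /=; rewrite in_itv/= ltr_distlC.
Qed.

Let nbhd n (z : n.-tuple R * n.-tuple R * R) (e : R) :=
  cube_nbhd z.1.1 e `*` cube_nbhd z.1.2 e `*` [set v | `|z.2 - v| < e].

Let measurable_nbhd n (z : n.-tuple R * n.-tuple R * R) e : measurable (nbhd z e).
Proof.
apply: measurableX; first by apply: measurableX; exact: measurable_cube_nbhd.
rewrite (_ : [set v | _] = `]z.2 - e, z.2 + e[%classic); first exact: measurable_itv.
by apply/seteqP; split => y /=; rewrite in_itv/= ltr_distlC.
Qed.

Let rat_point n (q : n.-tuple rat * n.-tuple rat * rat) : n.-tuple R * n.-tuple R * R :=
  (map_tuple ratr q.1.1, map_tuple ratr q.1.2, ratr q.2).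

Let rat_tuple_near n (x : n.-tuple R) (e : R) : 0 < e ->
  exists q : n.-tuple rat, forall i, `|ratr (tnth q i) - tnth x i| < e.
Proof.
move=> e0.
have near y : {q : rat | `|ratr q - y| < e}.
  apply: cid; have [q] := @rat_in_itvoo R (y - e) (y + e) ltac:(lra).
  by rewrite in_itv/= => qy; exists q; rewrite ltr_distl.
by exists [tuple sval (near (tnth x i)) | i < n] => i; rewrite tnth_mktuple; case: near.
Qed.

(* Second countability: the complement of the support is covered by the null cubes
   with rational centre and radius [1 / (k + 1)]. *)
Lemma ae_law_support n (Z : T -> n.-tuple R * n.-tuple R * R) :
  measurable_fun setT Z -> {ae P, forall w, law_support P Z (Z w)}.
Proof.
move=> mZ.
have mZn z e : measurable (Z @^-1` nbhd z e).
  by rewrite -[X in measurable X]setTI; apply: mZ => //; exact: measurable_nbhd.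
pose I : countType := (n.-tuple rat * n.-tuple rat * rat * nat)%type.
pose null (i : I) w :=
  P (Z @^-1` nbhd (rat_point i.1) i.2.+1%:R^-1) = 0%E ->
  ~ nbhd (rat_point i.1) i.2.+1%:R^-1 (Z w).
have null_ae i : {ae P, forall w, null i w}.
  have [P0|P0] := pselect (P (Z @^-1` nbhd (rat_point i.1) i.2.+1%:R^-1) = 0%E).
    exists (Z @^-1` nbhd (rat_point i.1) i.2.+1%:R^-1); split => // w /not_implyP[_].
    exact: contrapT.
  by apply: aeW => w.
have : {ae P, forall w, forall k, if @choice.unpickle I k is Some i then null i w else True}.
  by apply: ae_foralln => k; case: choice.unpickle => [i|]; [exact: null_ae|exact: aeW].
apply: filterS => w nullw e e0.
rewrite lt_neqAle measure_ge0 andbT eq_sym; apply/eqP => Pe0.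
(* With radius below [e / 2], a rational cube containing [Z w] lies in the cube of radius [e] around
   [Z w], so it is null if the latter is. *)
set k := Num.truncn (2 / e); have ke : k.+1%:R^-1 < e / 2.
  rewrite -[ltRHS]invrK ltf_pV2 ?posrE ?ltr0n ?invr_gt0 ?divr_gt0// invf_div.
  exact: truncnS_gt.
have k0 : 0 < k.+1%:R^-1 :> R by rewrite invr_gt0 ltr0n.
have [q1 q1P] := rat_tuple_near (Z w).1.1 k0.
have [q2 q2P] := rat_tuple_near (Z w).1.2 k0.
have [q3 q3P] := rat_tuple_near [tuple (Z w).2] k0.
pose i : I := (q1, q2, tnth q3 ord0, k).
have := nullw (choice.pickle i); rewrite choice.pickleK; apply.
  apply/eqP; rewrite -measure_le0 -Pe0; apply: le_measure; rewrite ?inE; try exact: mZn.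
  move: k0 ke q1P q2P q3P; set r := k.+1%:R^-1 => k0 ke q1P q2P q3P.
  have tri (a b c : R) : `|b - a| < r -> `|b - c| < r -> `|a - c| < e.
    rewrite !ltr_norml => /andP[? ?] /andP[? ?]; apply/andP; split; lra.
  move=> w' /= [[n1 n2] n3]; split; first split.
  - by move=> j; apply: tri (q1P j) _; have := n1 j; rewrite tnth_map.
  - by move=> j; apply: tri (q2P j) _; have := n2 j; rewrite tnth_map.
  - exact: tri (q3P ord0) n3.
split; first split.
- by move=> j; rewrite tnth_map; exact: q1P.
- by move=> j; rewrite tnth_map; exact: q2P.
- exact: q3P ord0.
Qed.

End support.

Section completion_facts.
Context d (T : measurableType d) (R : realType) (P : probability T R).

Lemma completionE (A : set T) : measurable A -> completion P A = P A.
Proof. by move=> mA; exact: measurable_mu_extE. Qed.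

Lemma measurable_completion d' (T' : measurableType d') (f : T -> T') :
  measurable_fun setT f ->
  @measurable_fun _ _ (caratheodory_type (P^*)%mu) T' setT f.
Proof. by move=> mf _ A mA; apply: caratheodory_measurable_mu_ext; exact: mf. Qed.

Lemma ae_completion (S : T -> Prop) :
  {ae P, forall w, S w} -> {ae completion P, forall w, S w}.
Proof.
move=> [N [mN N0 SN]]; exists N; split => //.
  exact: caratheodory_measurable_mu_ext.
exact: (etrans (completionE mN)).
Qed.

Lemma mutually_independent_pair d' (T' : measurableType d') (Z : nat -> T -> T') i j A :
    mutually_independent P Z -> i != j -> measurable A ->
  P (Z i @^-1` A `&` Z j @^-1` A) = (P (Z i @^-1` A) * P (Z j @^-1` A))%E.
Proof.
move=> indep ij mA; have := indep [fset i; j]%fset (fun=> A) (fun=> mA).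
rewrite big_fsetU1 ?inE//= big_seq_fset1 => <-; congr (P _).
apply/seteqP; split => [w [wi wj] k /=|w wA].
  by rewrite !inE => /orP[] /eqP ->.
by split; apply: wA; rewrite /= !inE eqxx ?orbT.
Qed.

End completion_facts.

Theorem theorem1 (R : realType) (D : nat) (prices : set R)
  (d : measure_display) (T : measurableType d) (P : probability T R)
  (L U : nat -> {RV P >-> D.-tuple R}) (V : nat -> {RV P >-> R})
  (g : (D + D).-tuple R -> R) :
  (1 <= D)%N ->
  closed prices -> prices !=set0 -> prices `<=` `[0, 1]%classic ->
  let Z := fun i w => (L i w, U i w, V i w) in
  mutually_independent P Z ->
  identically_distributed P Z ->
  (forall i, law_support P (Z i) `<=` feasible D `*` `[0, 1]%classic) ->
  has_density P (fun w => cat_tuple (L 0%N w) (U 0%N w)) g ->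
  {ae completion P, forall w,
    nu_hat prices L U V N w @[N --> \oo] --> nu_star P prices L U V}.
Proof.
move=> D0 pc pne p01 Z indep ident supp dens.
have mZ i : measurable_fun setT (Z i).
  by apply: measurable_fun_pair => //; exact: measurable_fun_pair.
have mZA i A : measurable A -> measurable (Z i @^-1` A).
  by move=> mA; rewrite -[X in measurable X]setTI; exact: mZ.
have mX : measurable_fun setT (fun w => cat_tuple (L 0%N w) (U 0%N w)).
  exact: measurable_cat_tuple.
(* The argument runs on the completed space. The completion agrees with [P] on measurable sets, so
   laws, independence and absolute continuity carry over, and feasibility holds because a random
   vector almost surely lies in its support. *)
apply: (@cvg_sample_value _ _ _ (completion P) D prices L U V) => //.
- by move=> i; exact: measurable_completion.
- by move=> i; exact: measurable_completion.
- by move=> i; exact: measurable_completion.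
- move=> i A mA; apply: etrans (completionE _ (mZA i A mA)) _.
  by rewrite (ident i 0%N)//; apply/esym/completionE; exact: mZA.
- move=> i j A ij mA; apply: etrans (completionE _ _) _.
    by apply: measurableI; exact: mZA.
  rewrite (mutually_independent_pair indep)//.
  by congr (_ * _)%E; apply/esym/completionE; exact: mZA.
- move=> i; apply: ae_completion.
  by apply: filterS (ae_law_support P (mZ i)) => w; exact: supp.
- move=> e e0; have [del del0 ac] := density_absolutely_continuous mX dens e0.
  exists del => // A mA Adel; apply: le_trans (ac A mA Adel).
  rewrite le_eqVlt; apply/orP; left; apply/eqP/completionE.
  by rewrite -[X in measurable X]setTI; exact: mX.
Qed.
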